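(* Let $\nu_0\in(-1/2,\infty)$, and let $f\in L^1_{2\nu_0+1,\,0}$ be such that $r\mapsto f(r^{1/2})$ is completely monotone on $(0,\infty)$. Then $T_\nu f$ is (real) analytic on $(0,\infty)$ for every $\nu\in[\nu_0,\infty)$.
   Context: $L^1_{\nu_1,\nu_2}$ is the space of measurable $f\colon(0,\infty)\to\mathbb{C}$ with $\int_0^1|f(r)|r^{\nu_1}\,dr+\int_1^\infty|f(r)|r^{\nu_2}\,dr<\infty$. For $\nu\in[-1/2,\infty)$, $T_\nu f(s):=\pi\int_0^\infty rs\,J_\nu(rs)^2f(r)\,dr$ for $s\in(0,\infty)$, where $J_\nu$ is the Bessel function of the first kind of order $\nu$ (a Lebesgue integral for $f\in L^1_{2\nu+1,0}$). A function $g\colon(0,\infty)\to\mathbb{R}$ is completely monotone if it is infinitely differentiable and $(-1)^ng^{(n)}(r)\ge0$ for every integer $n\ge0$ and every $r\in(0,\infty)$. *)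

(* Defs.v *)
From HB Require Import structures.
From mathcomp Require Import all_boot all_order all_algebra.
From mathcomp Require Import complex.
From mathcomp Require Import all_classical all_reals all_analysis.

Set Implicit Arguments.
Unset Strict Implicit.
Unset Printing Implicit Defensive.

Import Order.TTheory GRing.Theory Num.Theory.
Import numFieldNormedType.Exports.

Local Open Scope classical_set_scope.
Local Open Scope ring_scope.
Local Open Scope complex_scope.

(* A function on (0, oo) is represented by a total function on R; every
   definition below depends only on its values on (0, oo). *)

Section Transform.
Variable R : realType.
Local Notation mu := (@lebesgue_measure R).

(* Euler's integral; it is meant for x > 0. *)
Definition Gamma (x : R) : R :=
  \int[mu]_(t in `]0, +oo[) (t `^ (x - 1) * expR (- t)).

(* The Bessel function of the first kind of order nu, by its power series; it
   is meant for x > 0 and nu > -1, so that Gamma is only taken at positive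
   arguments. *)
Definition bessel_coef (nu x : R) (k : nat) : R :=
  (-1) ^+ k / (k`!%:R * Gamma (k%:R + nu + 1)) * (x / 2) `^ (k.*2%:R + nu).

Definition besselJ (nu x : R) : R := limn (series (bessel_coef nu x)).

Definition complex_measurable (D : set R) (f : R -> R[i]) : Prop :=
  measurable_fun D (fun r => complex.Re (f r)) /\
  measurable_fun D (fun r => complex.Im (f r)).

Definition complex_integral (D : set R) (f : R -> R[i]) : R[i] :=
  (\int[mu]_(r in D) complex.Re (f r)) +i* (\int[mu]_(r in D) complex.Im (f r)).

Definition in_L1 (nu1 nu2 : R) (f : R -> R[i]) : Prop :=
  complex_measurable `]0, +oo[ f /\
  (\int[mu]_(r in `]0%R, 1%R[) (Normc.normc (f r) * r `^ nu1)%:E +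
   \int[mu]_(r in `]1%R, +oo[) (Normc.normc (f r) * r `^ nu2)%:E
     < +oo)%E.

Definition T_transform (nu : R) (f : R -> R[i]) (s : R) : R[i] :=
  pi%:C * complex_integral `]0, +oo[
            (fun r => (r * s * besselJ nu (r * s) ^+ 2)%:C * f r).

Definition completely_monotone (g : R -> R) : Prop :=
  forall (n : nat) (r : R), 0 < r ->
    derivable (g^`(n))%classic r 1 /\ 0 <= (-1) ^+ n * (g^`(n))%classic r.

(* R[i]^o is R[i] with the topology given by its modulus. *)
Definition real_analytic_on (D : set R) (F : R -> R[i]) : Prop :=
  forall x0, D x0 -> exists a : nat -> R[i], \forall x \near x0,
    series (fun n => a n * (x - x0)%:C ^+ n : R[i]^o) @ \oo --> (F x : R[i]^o).

End Transform.

(* Main.v *)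
Require Import Defs.
From mathcomp Require Import all_boot all_order all_algebra.
From mathcomp Require Import complex.
From mathcomp Require Import all_classical all_reals all_analysis.
From mathcomp Require Import measurable_realfun.
From mathcomp Require Import ring lra.

(* Write f(r) = g(r^2) and w(u) = u J_nu(u)^2.  Scaling u = r s gives
   T_nu f(s) = (pi / s) G(1 / s^2) with G(y) = int_0^oo w(u) g(u^2 y) du.
   A completely monotone function is the sum of its Taylor series to the left of
   the base point, and all the terms of that series are nonnegative there; hence
   by Tonelli's theorem G(y0 - d) = sum_n A_n d^n with A_n >= 0, for
   0 <= d < y0 / 2, and neither Bernstein's theorem nor Weber's integral is
   needed.  Substituting d = y0 - 1 / s^2 preserves analyticity.  The integral
   G(y) is finite for every y > 0 because w(u) = O(u^(2 nu + 1)) at the origin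
   and w is bounded at infinity, the latter by an energy estimate for Bessel's
   equation. *)

Set Implicit Arguments.
Unset Strict Implicit.
Unset Printing Implicit Defensive.

Import Order.TTheory GRing.Theory Num.Theory.
Import numFieldNormedType.Exports.
Local Open Scope classical_set_scope.
Local Open Scope ring_scope.
Local Open Scope complex_scope.

(** * Power series with a weighted l^1 norm *)

Section PowerSeriesAlgebra.
Variable R : realType.
Implicit Types (t rho M : R).

(** The delicate step is the substitution d = y0 - 1 / s^2. The expansion of G is one-sided: it
    holds for d >= 0 only, so 1 / s0^2 must lie strictly to the left of y0, and d does not vanish at
    s = s0. Composing therefore rearranges a double series around a point that is not the centre of
    the outer series, and smallness of s - s0 alone does not justify this. The weighted l^1 norm
    does. It is submultiplicative, so if the series of d in powers of t = s - s0 has norm M, then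
    that of d^n has norm at most M^n; and since A_n >= 0, the sum of A_n M^n is G(y0 - M), which is
    finite as soon as M < y0 / 2. The range d < y0 / 2 is proportional to the base point. This is
    what lets one d serve all u under the integral: for g(u^2 y) both the base point and the
    increment are multiplied by u^2. *)

Lemma cvg_sumr m n (u : nat -> nat -> R) (l : nat -> R) :
  (forall k, u k @ \oo --> l k) ->
  (fun N => \sum_(m <= k < n) u k N) @ \oo --> \sum_(m <= k < n) l k.
Proof. by move=> ul; apply: cvg_big => //; exact: add_continuous. Qed.

Lemma bounded_nonneg_series_cvg (u : nat -> R) (M : R) :
  (forall n, 0 <= u n) -> (forall n, series u n <= M) -> cvgn (series u).
Proof.
move=> u0 uM; apply: nondecreasing_is_cvgn.
  by apply: nondecreasing_series => n _ _.
by exists M => _ [n _ <-].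
Qed.

Lemma bounded_series_cvg (u : nat -> R) (M : R) :
  (forall n, \sum_(0 <= k < n) `|u k| <= M) -> cvgn (series u).
Proof.
move=> uM; apply: normed_cvg.
exact: (@bounded_nonneg_series_cvg (fun k => `|u k|) M).
Qed.

Lemma le_norm_limn (u : nat -> R) (l M : R) N :
  u @ \oo --> l -> (forall n, (N <= n)%N -> `|u n| <= M) -> `|l| <= M.
Proof.
move=> ul uM; have nul : `|u n| @[n --> \oo] --> `|l| by exact: cvg_norm.
rewrite -(cvg_lim _ nul)//; apply: limr_le; first by apply/cvg_ex; exists `|l|.
by near=> n; apply: uM; near: n; exists N.
Unshelve. all: by end_near. Qed.

(* Tannery's theorem. *)
Lemma double_series_exchange (x : nat -> nat -> R) (A r c : nat -> R) (S H : R) :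
  (forall n K, \sum_(0 <= k < K) `|x n k| <= A n) ->
  (forall N, series A N <= S) ->
  (forall n, series (x n) @ \oo --> r n) ->
  (forall k, series (x ^~ k) @ \oo --> c k) ->
  series r @ \oo --> H -> series c @ \oo --> H.
Proof.
move=> xA AS xr xc rH.
have A0 n : 0 <= A n by have := xA n 0%N; rewrite big_geq.
have : cvgn (series A) by exact: (bounded_nonneg_series_cvg A0 AS).
move/cauchy_cvgP/cauchy_seriesP => Acauchy.
apply/cvgrPdist_le => e e0.
have e3 : 0 < e / 3 by rewrite divr_gt0.
have [[P Q] /= [PA QA] PQ] := Acauchy _ e3.
(* This [N] cuts the tail of the dominating series [A], hence, uniformly in [K], the tails in [n] of
   the double sum. The remaining finite block of [N] rows converges as [K] grows. *)
have {P Q PA QA PQ}[N NA] : exists N, forall n, \sum_(N <= k < n) A k <= e / 3.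
  case: PA QA => [a _ aP] [b _ bQ]; exists (maxn a b) => n.
  have [nab|nab] := leqP n (maxn a b); first by rewrite big_geq// ltW.
  apply: ltW; apply: le_lt_trans (ler_norm _) _; apply: (PQ (maxn a b, n)).
  split; [apply: aP|apply: bQ] => /=; first by rewrite leq_maxl.
  by rewrite (leq_trans _ (ltnW nab))// leq_maxr.
have tailK K N' : (N <= N')%N ->
   `|\sum_(N <= n < N') \sum_(0 <= k < K) x n k| <= e / 3.
  move=> _; apply: le_trans (NA N'); apply: le_trans (ler_norm_sum _ _ _) _.
  by apply: ler_sum => n _; apply: le_trans (ler_norm_sum _ _ _) (xA n K).
have tailc K : `|series c K - \sum_(0 <= n < N) \sum_(0 <= k < K) x n k| <= e / 3.
  have cv : (fun N' => \sum_(0 <= k < K) series (x ^~ k) N') @ \oo --> series c K.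
    apply: cvg_sumr => k; exact: xc.
  apply: (@le_norm_limn (fun N' => \sum_(0 <= k < K) series (x ^~ k) N' -
     \sum_(0 <= n < N) \sum_(0 <= k < K) x n k) _ _ N).
    by apply: cvgB => //; exact: cvg_cst.
  move=> N' NN'; rewrite /series/= exchange_big/=.
  by rewrite (big_cat_nat (leq0n N) NN')//= addrAC subrr add0r; exact: tailK.
have rA n : `|r n| <= A n.
  apply: (@le_norm_limn _ _ _ 0%N (xr n)) => K _.
  by apply: le_trans (ler_norm_sum _ _ _) (xA n K).
have tailr : `|H - \sum_(0 <= n < N) r n| <= e / 3.
  apply: (@le_norm_limn (fun N' => series r N' - \sum_(0 <= n < N) r n) _ _ N).
    by apply: cvgB => //; exact: cvg_cst.
  move=> N' NN'; rewrite /series/= (big_cat_nat (leq0n N) NN')//= addrAC subrr add0r.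
  apply: le_trans (ler_norm_sum _ _ _) _.
  by apply: le_trans (NA N'); apply: ler_sum => n _.
have : (fun K => \sum_(0 <= n < N) \sum_(0 <= k < K) x n k) @ \oo -->
       \sum_(0 <= n < N) r n.
  by apply: cvg_sumr => n; exact: xr.
move/cvgrPdist_le => /(_ _ e3) near_r; near=> K.
have h1 : `|\sum_(0 <= n < N) r n - \sum_(0 <= n < N) \sum_(0 <= k < K) x n k|
   <= e / 3 by near: K.
have h2 := tailc K.
move: tailr h1 h2; rewrite /series/= !ler_norml.
move: (\sum_(0 <= n < N) r n) => a.
move: (\sum_(0 <= n < N) \sum_(0 <= k < K) x n k) => b.
move: (\sum_(0 <= k < K) c k) => d *; lra.
Unshelve. all: by end_near. Qed.

(* [h] is on [-rho, rho] the sum of a power series of norm at most [M] in the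
   algebra of power series with the weighted l^1 norm [sum_k |b_k| rho^k]. *)
Definition power_series_norm_le rho M (h : R -> R) :=
  exists2 b : nat -> R,
    (forall K, \sum_(0 <= k < K) `|b k| * rho ^+ k <= M) &
    (forall t, `|t| <= rho -> series (fun k => b k * t ^+ k) @ \oo --> h t).

Lemma power_series_norm_le_bound rho M h t :
  power_series_norm_le rho M h -> `|t| <= rho -> `|h t| <= M.
Proof.
move=> [b bM bh] trho; apply: (@le_norm_limn _ _ _ 0%N (bh t trho)) => K _.
apply: le_trans (bM K); apply: le_trans (ler_norm_sum _ _ _) _.
apply: ler_sum => k _; rewrite normrM normrX ler_wpM2l//.
by apply: lerXn2r => //; rewrite nnegrE// (le_trans _ trho).
Qed.

(** The k-th coefficient of [H] is the sum over n of a_n b_(n,k). The triangle inequality bounds the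
    norm, and [double_series_exchange] identifies the sum of the new series. Products and
    compositions are both instances. *)
Lemma power_series_norm_le_superposition rho S (a M : nat -> R)
    (h : nat -> R -> R) (H : R -> R) : 0 <= rho ->
  (forall n, power_series_norm_le rho (M n) (h n)) ->
  (forall N, \sum_(0 <= n < N) `|a n| * M n <= S) ->
  (forall t, `|t| <= rho -> series (fun n => a n * h n t) @ \oo --> H t) ->
  power_series_norm_le rho S H.
Proof.
move=> rho0 hM aS aH.
pose b n := sval (cid2 (hM n)).
have bM n K : \sum_(0 <= k < K) `|b n k| * rho ^+ k <= M n.
  by rewrite /b; case: cid2.
have bh n t : `|t| <= rho -> series (fun k => b n k * t ^+ k) @ \oo --> h n t.
  by rewrite /b; case: cid2 => ? ? /= => /(_ t).
have abS K N :
    \sum_(0 <= n < N) \sum_(0 <= k < K) `|a n * b n k| * rho ^+ k <= S.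
  apply: le_trans (aS N); apply: ler_sum => n _.
  under eq_bigr do rewrite normrM -mulrA.
  by rewrite -mulr_sumr; apply: ler_wpM2l.
(* For [rho = 0] the norms say nothing about the coefficients of index k > 0, and [c k] may be a
   default value of [limn]. Then [t = 0], and the factor [t ^+ k] removes it; index 0 is treated
   separately. *)
have cvgc k : 0 < rho -> cvgn (series (fun n => a n * b n k)).
  move=> rhop; apply: (@bounded_series_cvg _ (S / rho ^+ k)) => N.
  rewrite ler_pdivlMr ?exprn_gt0// mulr_suml.
  apply: le_trans (abS k.+1 N); apply: ler_sum => n _.
  rewrite big_nat_recr//= lerDr; apply: sumr_ge0 => i _.
  by rewrite mulr_ge0// exprn_ge0.
have cvgc0 : cvgn (series (fun n => a n * b n 0%N)).
  apply: (@bounded_series_cvg _ S) => N.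
  apply: le_trans (abS 1%N N); apply: ler_sum => n _.
  by rewrite big_nat1 expr0 mulr1.
pose c k := limn (series (fun n => a n * b n k)).
have cc k t : `|t| <= rho ->
    series (fun n => a n * b n k * t ^+ k) @ \oo --> c k * t ^+ k.
  move=> trho; rewrite (_ : series _ =
    (fun N => series (fun n => a n * b n k) N * t ^+ k)); last first.
    by apply/funext => N; rewrite /series/= mulr_suml.
  case: k => [|k]; first by apply: cvgMl.
  have [->|t0] := eqVneq t 0.
    by rewrite expr0n/= mulr0; under eq_fun do rewrite mulr0; exact: cvg_cst.
  by apply: cvgMl; apply: cvgc; rewrite (lt_le_trans _ trho)// normr_gt0.
exists c.
  move=> K; have cv : (fun N => \sum_(0 <= k < K)
      `|series (fun n => a n * b n k * rho ^+ k) N|) @ \oo -->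
      \sum_(0 <= k < K) `|c k * rho ^+ k|.
    by apply: cvg_sumr => k; apply: cvg_norm; apply: cc; rewrite ger0_norm.
  have -> : \sum_(0 <= k < K) `|c k| * rho ^+ k = \sum_(0 <= k < K) `|c k * rho ^+ k|.
    by apply: eq_bigr => k _; rewrite normrM (ger0_norm (exprn_ge0 _ rho0)).
  rewrite -(cvg_lim (@norm_hausdorff _ _) cv).
  apply: limr_le; first by apply/cvg_ex; eexists; exact: cv.
  near=> N; apply: le_trans (abS K N).
  rewrite exchange_big/=; apply: ler_sum => k _.
  apply: le_trans (ler_norm_sum _ _ _) _; apply: ler_sum => n _.
  by rewrite normrM (ger0_norm (exprn_ge0 _ rho0)).
move=> t trho.
apply: (@double_series_exchange (fun n k => a n * b n k * t ^+ k)
  (fun n => `|a n| * M n) (fun n => a n * h n t) _ S (H t)) => //.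
- move=> n K; under eq_bigr do rewrite 2!normrM -mulrA.
  rewrite -mulr_sumr; apply: ler_wpM2l => //; apply: le_trans (bM n K).
  apply: ler_sum => k _; rewrite ler_wpM2l// normrX.
  by apply: lerXn2r => //; rewrite nnegrE.
- move=> n; rewrite (_ : series _ =
    (fun N => a n * series (fun k => b n k * t ^+ k) N)); last first.
    by apply/funext => N; rewrite /series/= mulr_sumr; under eq_bigr do rewrite -mulrA.
  by apply: cvgMr; exact: bh.
- by move=> k; exact: cc.
- exact: aH.
Unshelve. all: by end_near. Qed.

Lemma power_series_norm_le_monomial rho M h n : 0 <= rho ->
  power_series_norm_le rho M h ->
  power_series_norm_le rho (rho ^+ n * M) (fun t => t ^+ n * h t).
Proof.
move=> rho0 [b bM bh].
have shift (F : nat -> R) K : (n <= K)%N ->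
  (forall k, (k < n)%N -> F k = 0) ->
  \sum_(0 <= k < K) F k = \sum_(0 <= k < K - n) F (k + n)%N.
  move=> nK F0; rewrite (big_cat_nat (leq0n n) nK)//= big_nat big1 ?add0r => [|i /andP[_ /F0]//].
  by rewrite -{1}[n]add0n big_addn.
pose b' k := if (k < n)%N then 0 else b (k - n)%N.
have b'E k : b' (k + n)%N = b k by rewrite /b' ltnNge leq_addl/= addnK.
exists b' => [K|t trho].
  have b'0 k : 0 <= `|b' k| * rho ^+ k by rewrite mulr_ge0// exprn_ge0.
  apply: (@le_trans _ _ (\sum_(0 <= k < K + n) `|b' k| * rho ^+ k)).
    by rewrite (big_cat_nat (leq0n K) (leq_addr n K))//= lerDl sumr_ge0.
  rewrite shift ?leq_addl// => [|k kn]; last by rewrite /b' kn normr0 mul0r.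
  rewrite addnK; under eq_bigr do rewrite b'E exprD mulrA mulrC.
  by rewrite -mulr_sumr ler_wpM2l// exprn_ge0.
rewrite -(cvg_shiftn n) (_ : [sequence _]_ _ =
    (fun K => t ^+ n * series (fun k => b k * t ^+ k) K)); last first.
  apply/funext => K; rewrite /series/= shift ?leq_addl// => [|k kn]; last first.
    by rewrite /b' kn mul0r.
  by rewrite addnK mulr_sumr; apply: eq_bigr => k _; rewrite b'E exprD; ring.
by apply: cvgMr; exact: bh.
Qed.

(** The product is the superposition, weighted by the coefficients of [f], of the functions t^n
    g(t), whose norms are at most rho^n N. *)
Lemma power_series_norm_leM rho M N f g : 0 <= rho ->
  power_series_norm_le rho M f -> power_series_norm_le rho N g ->
  power_series_norm_le rho (M * N) (fun t => f t * g t).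
Proof.
move=> rho0 [b bM bf] gN.
have N0 : 0 <= N.
  by apply: le_trans (power_series_norm_le_bound gN (_ : `|0| <= rho)); rewrite ?normr0.
apply: (@power_series_norm_le_superposition rho _ b (fun n => rho ^+ n * N)
   (fun n t => t ^+ n * g t)) => //.
- by move=> n; exact: power_series_norm_le_monomial.
- by move=> K; under eq_bigr do rewrite mulrA; rewrite -mulr_suml ler_wpM2r.
- move=> t trho; rewrite (_ : series _ =
     (fun K => series (fun k => b k * t ^+ k) K * g t)); last first.
    by apply/funext => K; rewrite /series/= mulr_suml; under eq_bigr do rewrite mulrA.
  by apply: cvgMl; exact: bf.
Qed.

Lemma power_series_norm_le_cst rho c : power_series_norm_le rho `|c| (fun=> c).
Proof.
exists (fun k => if k is 0%N then c else 0) => [[|K]|t _].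
- by rewrite big_geq.
- by rewrite big_nat_recl//= expr0 mulr1 big1 ?addr0// => i _; rewrite normr0 mul0r.
- rewrite -cvg_shiftS (_ : [sequence _]_ _ = (fun=> c)); first exact: cvg_cst.
  apply/funext => K; rewrite /series/= big_nat_recl//= expr0 mulr1 big1 ?addr0// => i _.
  by rewrite mul0r.
Qed.

Lemma power_series_norm_leD rho M N f g :
  power_series_norm_le rho M f -> power_series_norm_le rho N g ->
  0 <= rho -> power_series_norm_le rho (M + N) (fun t => f t + g t).
Proof.
move=> [b bM bf] [c cN cg] rho0; exists (fun k => b k + c k) => [K|t trho].
  apply: le_trans (lerD (bM K) (cN K)); rewrite -big_split/=.
  by apply: ler_sum => k _; rewrite -mulrDl ler_wpM2r ?exprn_ge0// ler_normD.
rewrite (_ : series _ = series (fun k => b k * t ^+ k) \+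
                        series (fun k => c k * t ^+ k)); last first.
  by apply/funext => K; rewrite /series/= -big_split/=; under eq_bigr do rewrite mulrDl.
by apply: cvgD; [exact: bf|exact: cg].
Qed.

Lemma power_series_norm_leX rho M f n : 0 <= rho ->
  power_series_norm_le rho M f ->
  power_series_norm_le rho (M ^+ n) (fun t => f t ^+ n).
Proof.
move=> rho0 fM; elim: n => [|n ih].
  by rewrite -[M ^+ 0]normr1; exact: power_series_norm_le_cst.
by rewrite exprS; under [X in power_series_norm_le _ _ X]eq_fun do rewrite exprS;
  exact: power_series_norm_leM.
Qed.

(** This is the geometric series of ratio -t / s. Its terms are all positive at t = -rho, so the
    norm is the value taken there. *)
Lemma power_series_norm_le_inv rho s : 0 <= rho < s ->
  power_series_norm_le rho (s - rho)^-1 (fun t => (s + t)^-1).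
Proof.
move=> /andP[rho0 rhos].
have s0 : 0 < s by lra.
exists (fun k => s^-1 * (- s^-1) ^+ k) => [K|t trho].
  have q1 : `|rho / s| < 1 by rewrite ger0_norm ?ltr_pdivrMr ?mul1r// divr_ge0// ltW.
  have := @cvg_geometric_series _ s^-1 _ q1.
  have -> : s^-1 * (1 - rho / s)^-1 = (s - rho)^-1 by field; lra.
  have gE k : geometric s^-1 (rho / s) k = `|s^-1 * (- s^-1) ^+ k| * rho ^+ k.
    rewrite /= normrM normrX normrN ger0_norm ?invr_ge0 1?ltW//.
    by rewrite -mulrA -exprMn [rho / s]mulrC.
  move=> cv; rewrite -(cvg_lim _ cv)//.
  under eq_bigr do rewrite -gE.
  apply: nondecreasing_cvgn_le; last by apply/cvg_ex; eexists; exact: cv.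
  by apply: nondecreasing_series => k _ _; rewrite gE mulr_ge0// exprn_ge0.
have q1 : `|- t / s| < 1.
  by rewrite normrM normrN normfV (gtr0_norm s0) ltr_pdivrMr// mul1r (le_lt_trans trho).
have -> : (s + t)^-1 = s^-1 * (1 - (- t / s))^-1.
  by move: trho; rewrite ler_norml => /andP[? ?]; field; lra.
rewrite (_ : (fun k => _) = geometric s^-1 (- t / s)); first exact: cvg_geometric_series.
by apply/funext => k /=; rewrite -mulrA -exprMn; congr (_ * _ ^+ _); ring.
Qed.

Lemma power_series_norm_le_id rho : 0 <= rho -> power_series_norm_le rho rho id.
Proof.
move=> rho0; have := power_series_norm_le_monomial 1 rho0 (power_series_norm_le_cst rho 1).
by rewrite expr1 normr1 mulr1; under [X in power_series_norm_le _ _ X]eq_fun do rewrite expr1 mulr1.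
Qed.

End PowerSeriesAlgebra.

(** * Absolutely and completely monotone functions *)

Section AbsolutelyMonotone.
Variable R : realType.

Lemma is_derive_ge0_le (f df : R -> R) (a b : R) : a <= b ->
  (forall x, a <= x <= b -> is_derive x 1 f (df x)) ->
  (forall x, a <= x <= b -> 0 <= df x) -> f a <= f b.
Proof.
move=> ab fdf df0.
have cf : {within `[a, b], continuous f}.
  apply: derivable_within_continuous => x; rewrite in_itv/= => xab.
  by have := fdf _ xab => -[].
have [x|x xab eqf] := @MVT_segment R f df a b ab _ cf.
  by rewrite in_itv/= => /andP[ax xb]; apply: fdf; rewrite !ltW.
rewrite -subr_ge0 eqf mulr_ge0 ?subr_ge0//; apply: df0.
by move: xab; rewrite in_itv.
Qed.

Lemma is_derive_mull (c : R) (f : R -> R) (x df : R) : is_derive x 1 f df ->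
  is_derive x 1 (fun y => c * f y) (c * df).
Proof. exact: is_deriveZ. Qed.

Lemma is_derive_mul (f g : R -> R) (x df dg : R) : is_derive x 1 f df ->
  is_derive x 1 g dg -> is_derive x 1 (fun y => f y * g y) (f x * dg + df * g x).
Proof.
by move=> hf hg; have := is_deriveM hf hg; rewrite /GRing.scale/= [g x * _]mulrC.
Qed.

Lemma is_derive_exprn n (x : R) :
  is_derive x 1 (fun y => y ^+ n) (n%:R * x ^+ n.-1).
Proof.
apply: DeriveDef; first exact: exprn_derivable.
by rewrite exp_derive /GRing.scale/= mulr1.
Qed.

Lemma is_derive_exp_term (c : R) N (x : R) :
  is_derive x 1 (fun y => c * y ^+ N.+1 / N.+1`!%:R) (c * x ^+ N / N`!%:R).
Proof.
under eq_fun do rewrite mulrAC.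
have := is_derive_mull (c / N.+1`!%:R) (is_derive_exprn N.+1 x).
rewrite (_ : _ * (_ * _) = c * x ^+ N / N`!%:R)// factS natrM.
have f0 : N`!%:R != 0 :> R by rewrite pnatr_eq0 -lt0n fact_gt0.
by field; rewrite f0/= addrC natr1 pnatr_eq0.
Qed.

Lemma is_derive_exp_series (a : nat -> R) N (x : R) :
  is_derive x 1 (fun y => \sum_(0 <= n < N.+1) a n * y ^+ n / n`!%:R)
    (\sum_(0 <= n < N) a n.+1 * x ^+ n / n`!%:R).
Proof.
elim: N => [|N ih].
  rewrite big_geq//; under eq_fun do rewrite big_nat1 expr0.
  exact: is_derive_cst.
rewrite big_nat_recr//=; under eq_fun do rewrite big_nat_recr//=.
by apply: is_deriveD => //; exact: is_derive_exp_term.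
Qed.

(** [phi] lists a function with all its derivatives. Dropping the first entry gives the same
    property for the derivative, which drives the inductions below. *)
Definition absolutely_monotone (X : R) (phi : nat -> R -> R) :=
  forall n d, d < X -> is_derive d 1 (phi n) (phi n.+1 d) /\ 0 <= phi n d.

Lemma absolutely_monotone_shift X phi e : absolutely_monotone X phi ->
  absolutely_monotone (X - e) (fun n d => phi n (e + d)).
Proof.
move=> H n d dX; have dX' : e + d < X by lra.
have [h1 h2] := H n (e + d) dX'; split => //.
have h3 : is_derive d 1 (fun d => e + d) 1.
  by rewrite -[X in is_derive _ _ _ X]add0r; apply: is_deriveD.
by have := is_derive1_comp h1 h3; rewrite mulr1.
Qed.

(** The difference of the two sides vanishes at 0, and its derivative is the same difference for the
    shifted sequence, nonnegative by induction. *)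
Lemma absolutely_monotone_taylor_le X phi N (d : R) : absolutely_monotone X phi ->
  0 <= d < X -> \sum_(0 <= n < N) phi n 0 * d ^+ n / n`!%:R <= phi 0%N d.
Proof.
elim: N phi d => [|N ih] phi d am /andP[d0 dX].
  by rewrite big_geq//; have [] := am 0%N d dX.
rewrite -subr_ge0.
have am' : absolutely_monotone X (fun n => phi n.+1) by move=> n; exact: am.
pose f y := phi 0%N y - \sum_(0 <= n < N.+1) phi n 0 * y ^+ n / n`!%:R.
have f0 : f 0 = 0.
  rewrite /f big_nat_recl//= expr0 mulr1 fact0 divr1 big1 ?addr0 ?subrr// => i _.
  by rewrite exprS mul0r mulr0 mul0r.
suff : f 0 <= f d by rewrite f0.
apply: (@is_derive_ge0_le f (fun x => phi 1%N x -
   \sum_(0 <= n < N) phi n.+1 0 * x ^+ n / n`!%:R)) => // x /andP[x0 xd].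
- apply: is_deriveB; last exact: is_derive_exp_series.
  by have [] := am 0%N x (le_lt_trans xd dX).
- by rewrite subr_ge0 (ih _ _ am')// x0 (le_lt_trans xd dX).
Qed.

Lemma absolutely_monotone_homo X phi n (d e : R) : absolutely_monotone X phi ->
  d <= e < X -> phi n d <= phi n e.
Proof.
move=> am /andP[de eX]; apply: (is_derive_ge0_le (df := phi n.+1)) => // x /andP[dx xe].
  by have [] := am n x (le_lt_trans xe eX).
by have [] := am n.+1 x (le_lt_trans xe eX).
Qed.

(** The same induction, started from the monotonicity of [phi 0]. The bound [D] on the increment
    stays fixed while [d] varies, so that [phi N D] is a constant under differentiation. *)
Lemma absolutely_monotone_taylor_remainder X phi N (d D : R) : absolutely_monotone X phi ->
  0 <= d <= D -> D < X ->
  phi 0%N d <= \sum_(0 <= n < N) phi n 0 * d ^+ n / n`!%:R + phi N D * d ^+ N / N`!%:R.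
Proof.
move=> am dD DX; elim: N phi d dD am => [|N ih] phi d /andP[d0 dD] am.
  rewrite big_geq// expr0 mulr1 fact0 divr1 add0r.
  by apply: (@absolutely_monotone_homo X phi 0 d D am); rewrite dD.
rewrite -subr_ge0.
have am' : absolutely_monotone X (fun n => phi n.+1) by move=> n; exact: am.
pose f y := \sum_(0 <= n < N.+1) phi n 0 * y ^+ n / n`!%:R +
  phi N.+1 D * y ^+ N.+1 / N.+1`!%:R - phi 0%N y.
have f0 : f 0 = 0.
  rewrite /f big_nat_recl//= expr0 mulr1 fact0 divr1 big1 ?addr0 => [|i _].
    by rewrite exprS mul0r mulr0 mul0r addr0 subrr.
  by rewrite exprS mul0r mulr0 mul0r.
suff : f 0 <= f d by rewrite f0.
apply: (@is_derive_ge0_le f (fun x =>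
   \sum_(0 <= n < N) phi n.+1 0 * x ^+ n / n`!%:R +
   phi N.+1 D * x ^+ N / N`!%:R - phi 1%N x)) => // x /andP[x0 xd].
- apply: is_deriveB; last by have [] := am 0%N x (le_lt_trans xd (le_lt_trans dD DX)).
  apply: is_deriveD; first exact: is_derive_exp_series.
  exact: is_derive_exp_term.
- by rewrite subr_ge0 (ih _ _ _ am')// x0 (le_trans xd dD).
Qed.

(** The remainder is at most phi_N(d) d^N / N!. Expanding at [d] with increment X / 2 and keeping
    one nonnegative term gives phi_N(d) (X / 2)^N / N! <= phi_0(d + X / 2). So the remainder decays
    like (d / (X / 2))^N; the condition d < X / 2 makes this ratio less than 1 and keeps d + X / 2
    below X. *)
Lemma absolutely_monotone_taylor_cvg X phi (d : R) : absolutely_monotone X phi ->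
  0 <= d < X / 2 ->
  series (fun n => phi n 0 * d ^+ n / n`!%:R) @ \oo --> phi 0%N d.
Proof.
move=> am /andP[d0 dX].
have X0 : 0 < X by lra.
pose q := d / (X / 2).
have q1 : `|q| < 1.
  by rewrite ger0_norm ?ltr_pdivrMr ?mul1r// ?divr_ge0//; lra.
have remainder N : 0 <= phi 0%N d - series (fun n => phi n 0 * d ^+ n / n`!%:R) N <=
    phi 0%N (d + X / 2) * q ^+ N.
  apply/andP; split.
    by rewrite subr_ge0; apply: (absolutely_monotone_taylor_le _ am); lra.
  rewrite lerBlDl; apply: le_trans (absolutely_monotone_taylor_remainder N (D := d) am _ _) _.
  - by lra.
  - by lra.
  rewrite lerD2l.
  have shift := absolutely_monotone_shift (e := d) am.
  have := absolutely_monotone_taylor_le (d := X / 2) N.+1 shift.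
  rewrite big_nat_recr//= addr0.
  have : 0 <= \sum_(0 <= n < N) phi n d * (X / 2) ^+ n / n`!%:R.
    apply: sumr_ge0 => n _; rewrite divr_ge0// mulr_ge0 ?exprn_ge0//; last by lra.
    by have [] := am n d ltac:(lra).
  move=> s0 /(_ ltac:(lra)) sX.
  have {sX}sX : phi N d * (X / 2) ^+ N / N`!%:R <= phi 0%N (d + X / 2) by lra.
  have -> : phi N d * d ^+ N / N`!%:R = phi N d * (X / 2) ^+ N / N`!%:R * q ^+ N.
    have : (X / 2) ^+ N != 0 by rewrite expf_neq0//; lra.
    rewrite /q (exprMn N d) exprVn; move: ((X / 2) ^+ N) => c c0; field.
    by rewrite c0 pnatr_eq0 -lt0n fact_gt0.
  by apply: ler_wpM2r => //; rewrite exprn_ge0// divr_ge0//; lra.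
have cv0 : (fun N => phi 0%N (d + X / 2) * q ^+ N) @ \oo --> 0.
  by rewrite -(mulr0 (phi 0%N (d + X / 2))); apply: cvgMr; exact: cvg_expr.
apply: cvg_sub0 (cvg_cst (phi 0%N d)).
apply/cvgrPdist_le => e e0; near=> N; rewrite sub0r normrN.
have := remainder N; rewrite distrC => /andP[r0 r1].
rewrite [X in X <= _]ger0_norm//; apply: le_trans r1 _; apply: le_trans (ler_norm _) _.
near: N; have /cvgr0Pnorm_le := cv0; exact.
Unshelve. all: by end_near. Qed.

Lemma completely_monotone_absolutely_monotone (g : R -> R) x :
  completely_monotone g ->
  absolutely_monotone x (fun n d => (-1) ^+ n * (g^`(n))%classic (x - d)).
Proof.
move=> cm n d dx; have xd : 0 < x - d by lra.
have [dg g0] := cm n (x - d) xd; split => //.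
have h1 : is_derive (x - d) 1 (g^`(n))%classic ((g^`(n.+1))%classic (x - d)).
  by rewrite derive1nS derive1E; exact: derivableP.
have h3 : is_derive d 1 (fun d => x - d) (-1).
  by rewrite -[X in is_derive _ _ _ X]add0r; apply: is_deriveB.
have h2 := @is_derive1_comp R (g^`(n))%classic (fun d => x - d) d _ _ h1 h3.
have := is_derive_mull ((-1) ^+ n) h2.
rewrite (_ : (-1) ^+ n * (_ * -1) = (-1) ^+ n.+1 * (g^`(n.+1))%classic (x - d)) // exprS; ring.
Qed.

End AbsolutelyMonotone.

(** * Euler's integral *)

Section GammaRecurrence.
Variable R : realType.
Local Notation mu := (@lebesgue_measure R).
Implicit Types x a b : R.

Lemma continuous_powR_gt0 a b : 0 < b -> {for b, continuous (fun t : R => t `^ a)}.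
Proof.
move=> b0; apply: differentiable_continuous; apply/derivable1_diffP.
by have [] := @is_derive1_powR R a b b0.
Qed.

Lemma cvg_powR_expRN x : (n.+2%:R : R) `^ x * expR (- n.+2%:R) @[n --> \oo] --> (0 : R).
Proof.
(* With m >= x, the inequalities t^x <= t^m for t >= 1 and e^t >= t^(m+1) / (m+1)! bound the product
   by (m+1)! / t. *)
pose m := (Num.truncn `|x|).+1.
have xm : x <= m%:R by apply: le_trans (ler_norm _) _; apply: ltW; rewrite /m truncnS_gt.
apply: (@squeeze_cvgr _ _ _ _ (fun=> 0) (fun n => m.+1`!%:R * n.+2%:R^-1)).
- near=> n; rewrite mulr_ge0 ?powR_ge0 ?expR_ge0//=.
  have n0 : 0 < n.+2%:R :> R by [].
  have n1 : 1 <= n.+2%:R :> R by rewrite ler1n.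
  rewrite expRN ler_pdivrMr ?expR_gt0//.
  apply: le_trans (ler_powR n1 xm) _; rewrite powR_mulrn//.
  rewrite -mulrA -ler_pdivrMl ?ltr0n ?fact_gt0// ler_pdivlMl//.
  apply: le_trans (expR_ge1Dxn m (ltW n0)).
  by rewrite mulrCA -exprS mulrC lerDr.
- exact: cvg_cst.
- rewrite -(mulr0 (m.+1`!%:R : R)); apply: cvgMr.
  by have := @cvg_harmonic R; rewrite -cvg_shiftS.
Unshelve. all: by end_near. Qed.

Lemma cvg_invn_powR_expRN x : 0 < x ->
  (n.+2%:R^-1 : R) `^ x * expR (- n.+2%:R^-1) @[n --> \oo] --> (0 : R).
Proof.
move=> x0; rewrite (_ : 0 = 0 * expR (- 0) :> R); last by rewrite mul0r.
have hv : (n.+2%:R^-1 : R) @[n --> \oo] --> (0 : R).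
  by have := @cvg_harmonic R; rewrite -cvg_shiftS.
apply: cvgM.
  by move/cvg_at_rightP : (powR_cvg0 x0); apply; split => // n; rewrite invr_gt0.
apply: (@cvg_comp _ _ _ (fun n => - n.+2%:R^-1) expR _ (nbhs (- 0 : R)));
  last exact: continuous_expR.
exact: cvgN.
Qed.

Definition gamma_integrand x (t : R) : R := t `^ (x - 1) * expR (- t).

Lemma measurable_gamma_integrand x (D : set R) :
  measurable_fun D (EFin \o gamma_integrand x).
Proof.
apply/measurable_EFinP/(@measurable_funS _ _ _ _ setT) => //.
apply: measurable_funM; first exact: measurable_powR.
by apply: (measurableT_comp (@measurable_expR R)); exact: oppr_measurable.
Qed.

(** Integration by parts on compact intervals exhausting the half-line, followed by monotone
    convergence. In the extended reals the identity can be stated before any finiteness is known. *)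
Lemma integral_gamma_integrand_recurrence x : 0 < x ->
  (\int[mu]_(t in `]0%R, +oo[) (gamma_integrand (x + 1) t)%:E =
   x%:E * \int[mu]_(t in `]0%R, +oo[) (gamma_integrand x t)%:E)%E.
Proof.
move=> x0.
(* The shift by 2 gives 1 / (n + 2) < 1 < n + 2 already at n = 0, so that no interval is
   degenerate. *)
pose I n : set R := `[n.+2%:R^-1, n.+2%:R]%classic.
have I0 n t : I n t -> 0 < t.
  by rewrite /I /= in_itv/= => /andP[nt _]; rewrite (lt_le_trans _ nt)// invr_gt0.
have bigI : \bigcup_n I n = `]0, +oo[%classic.
  apply/seteqP; split => [t [n _ /I0 t0]|t]; rewrite /= in_itv/= ?t0// andbT => t0.
  exists (Num.truncn (t + t^-1)) => //; rewrite /I /= in_itv/=.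
  have tt : t + t^-1 <= (Num.truncn (t + t^-1)).+2%:R.
    apply: ltW; apply: lt_trans (truncnS_gt _) _.
    by rewrite ltr_nat.
  have t1 : 0 < t^-1 by rewrite invr_gt0.
  apply/andP; split; last by lra.
  by rewrite -[leRHS]invrK lef_pV2 ?posrE//; lra.
have cvgI y : (\int[mu]_(t in I n) (gamma_integrand y t)%:E @[n --> \oo] -->
    \int[mu]_(t in `]0%R, +oo[) (gamma_integrand y t)%:E)%E.
  rewrite -bigI; apply: ge0_nondecreasing_set_cvg_integral => //.
  - apply/nondecreasing_seqP => n; apply/subsetPset => t; rewrite /I/= !in_itv/=.
    move=> /andP[h1 h2]; apply/andP; split.
      by apply: le_trans h1; rewrite lef_pV2 ?posrE// ler_nat.
    by apply: le_trans h2 _; rewrite ler_nat.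
  - by move=> n; exact: measurable_itv.
  - by move=> n; exact: measurable_gamma_integrand.
  - by move=> n t _; rewrite lee_fin mulr_ge0 ?powR_ge0 ?expR_ge0.
pose beta n : R := (n.+2%:R^-1) `^ x * expR (- n.+2%:R^-1) -
   n.+2%:R `^ x * expR (- n.+2%:R).
have ibp n : (\int[mu]_(t in I n) (gamma_integrand (x + 1) t)%:E =
   (beta n)%:E + x%:E * \int[mu]_(t in I n) (gamma_integrand x t)%:E)%E.
  have ab : n.+2%:R^-1 < n.+2%:R :> R.
    by apply: (@lt_trans _ _ 1); rewrite ?invf_lt1// ltr1n.
  have a0 : 0 < n.+2%:R^-1 :> R by rewrite invr_gt0.
  have Ioo0 t : t \in `]n.+2%:R^-1, n.+2%:R[%R -> 0 < t.
    by rewrite in_itv/= => /andP[nt _]; rewrite (lt_trans _ nt).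
  have cpow y : {within `[n.+2%:R^-1, n.+2%:R], continuous (fun t : R => t `^ y)}.
    by apply: continuous_in_subspaceT => t; rewrite inE => /I0; exact: continuous_powR_gt0.
  have dG (t : R) : is_derive t 1 (fun s : R => - expR (- s)) (expR (- t)).
    have := is_deriveN (@is_derive1_comp R expR (@GRing.opp R) t _ _
      (is_derive_expR _) (is_deriveNid _ _)).
    by rewrite mulrN1 opprK.
  have cG : continuous (fun s : R => - expR (- s)).
    move=> t; apply: differentiable_continuous; apply/derivable1_diffP.
    by have [] := dG t.
  have := @integration_by_parts R (fun t : R => t `^ x) (fun s => - expR (- s))
    (fun s => x * s `^ (x - 1)) (fun s => expR (- s)) _ _ ab.
  have -> : (\int[mu]_(t in I n) (gamma_integrand (x + 1) t)%:E =
     \int[mu]_(t in I n) (t `^ x * expR (- t))%:E)%E.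
    by apply: eq_integral => t _; rewrite /gamma_integrand addrK.
  move=> -> //.
  - have -> : (n.+2%:R `^ x * - expR (- n.+2%:R) -
       n.+2%:R^-1 `^ x * - expR (- n.+2%:R^-1)) = beta n.
      by rewrite /beta; ring.
    congr (_ + _)%E.
    rewrite -ge0_integralZl_EFin//; last 4 first.
    + exact: measurable_itv.
    + by move=> t _; rewrite lee_fin mulr_ge0 ?powR_ge0 ?expR_ge0.
    + exact: measurable_gamma_integrand.
    + exact: ltW.
    rewrite -integralN/=.
      apply: eq_integral => t _; rewrite -EFinM; congr EFin.
      by rewrite /gamma_integrand; ring.
    apply: fin_num_adde_defl; rewrite fin_numN.
    apply: integrable_neg_fin_num => //.
    apply: continuous_compact_integrable; first exact: segment_compact.
    apply: continuous_in_subspaceT => t; rewrite inE => /I0 t0.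
    apply: cvgM; last exact: cG.
    by apply: cvgMr; exact: continuous_powR_gt0.
  - by move=> t; apply: cvgMr; exact: cpow.
  - have /(continuous_within_itvP _ ab)[_ ? ?] := cpow x.
    by split => // t /= /Ioo0 t0; have [] := @is_derive1_powR R x t t0.
  - by move=> t /Ioo0 t0; rewrite powR_derive1// in_itv/= t0.
  - by apply: continuous_subspaceT => t; apply: (@cvg_comp _ _ _ -%R expR _ (nbhs (- t)));
      [exact: opp_continuous|exact: continuous_expR].
  - split => [t _||]; first by have [] := dG t.
      exact/cvg_at_right_filter/cG.
    exact/cvg_at_left_filter/cG.
  - by move=> t _; rewrite derive1E; have [_] := dG t.
have cvgbeta : (beta n)%:E @[n --> \oo] --> 0%:E.
  apply: cvg_EFin; first by near=> n.
  rewrite -[X in _ --> X](subr0 0); apply: cvgB.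
    exact: cvg_invn_powR_expRN.
  exact: cvg_powR_expRN.
have h : (\int[mu]_(t in I n) (gamma_integrand (x + 1) t)%:E @[n --> \oo] -->
    0%:E + x%:E * \int[mu]_(t in `]0%R, +oo[) (gamma_integrand x t)%:E)%E.
  under eq_fun do rewrite ibp.
  apply: cvgeD => //.
  by apply: cvgeZl.
rewrite add0e in h.
by rewrite -(cvg_lim _ h)//; apply/esym/cvg_lim.
Unshelve. all: by end_near. Qed.

Lemma Gamma_recurrence x : 0 < x -> Gamma (x + 1) = x * Gamma x.
Proof.
move=> x0; rewrite /Gamma /Rintegral -/(gamma_integrand (x + 1)).
have := integral_gamma_integrand_recurrence x0.
rewrite /gamma_integrand => ->.
set L := (\int[_]_(_ in _) _)%E.
have : (0 <= L)%E.
  by apply: integral_ge0 => t _; rewrite lee_fin mulr_ge0 ?powR_ge0 ?expR_ge0.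
(* If [L] were infinite, [fine] would turn both integrals into 0, and the identity would read 0 = x
   * 0. *)
move: L => [L|_|]//=.
by rewrite gt0_muley ?lte_fin//= mulr0.
Qed.

End GammaRecurrence.

(** * Bessel functions *)

Section EntireSeries.
Variable R : realType.
Implicit Types (a : nat -> R) (x : R).

(** This growth condition is stable under formal differentiation, so it supplies at every point all
    the convergence hypotheses of termwise differentiation. *)
Definition exp_bounded a := exists2 CB : R * R, 0 <= CB.1 /\ 0 <= CB.2 &
  forall k, `|a k| <= CB.1 * CB.2 ^+ k / k`!%:R.

Lemma exp_bounded_diffs a : exp_bounded a -> exp_bounded (pseries_diffs a).
Proof.
move=> [[C B] /= [C0 B0] aCB]; exists (C * B, B) => /=; first by split => //; exact: mulr_ge0.
move=> k; rewrite /pseries_diffs normrM ger0_norm//.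
have := aCB k.+1; rewrite factS natrM.
have f0 : 0 < k`!%:R :> R by rewrite ltr0n fact_gt0.
have k0 : 0 < k.+1%:R :> R by [].
rewrite !ler_pdivlMr ?mulr_gt0// exprS mulrA; congr (_ <= _).
by ring.
Qed.

Lemma exp_bounded_cvg a x : exp_bounded a -> cvgn (pseries a x).
Proof.
move=> [[C B] /= [C0 B0] aCB].
apply: (@bounded_series_cvg R _ (C * expR (B * `|x|))) => n.
apply: (@le_trans _ _ (C * series (exp_coeff (B * `|x|)) n)).
  rewrite /series/= mulr_sumr; apply: ler_sum => k _.
  rewrite normrM normrX.
  apply: le_trans (ler_wpM2r (exprn_ge0 k (normr_ge0 x)) (aCB k)) _.
  by rewrite /exp_coeff/= exprMn; rewrite le_eqVlt; apply/orP; left; apply/eqP; ring.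
rewrite ler_wpM2l//; apply: nondecreasing_cvgn_le.
  by apply: nondecreasing_series => k _ _; rewrite exp_coeff_ge0// mulr_ge0.
exact: is_cvg_series_exp_coeff.
Qed.

Definition psum a x : R := limn (pseries a x).

Lemma is_derive_psum a x : exp_bounded a ->
  is_derive x 1 (psum a) (psum (pseries_diffs a) x).
Proof.
move=> ha; apply: (@pseries_snd_diffs R a (`|x| + 1) x).
- exact: exp_bounded_cvg.
- exact/exp_bounded_cvg/exp_bounded_diffs.
- exact/exp_bounded_cvg/exp_bounded_diffs/exp_bounded_diffs.
- by rewrite [ltRHS]ger0_norm ?ltrDl// addr_ge0.
Qed.

Lemma pseries_cvg a x : exp_bounded a -> pseries a x @ \oo --> psum a x.
Proof. exact: exp_bounded_cvg. Qed.

End EntireSeries.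

Lemma powRD_gt0 (R : realType) (x r s : R) : 0 < x -> x `^ (r + s) = x `^ r * x `^ s.
Proof. by move=> x0; rewrite powRD// (gt_eqF x0) implybT. Qed.

Section Bessel.
Variables (R : realType) (nu : R).
Hypothesis hnu : - (1 / 2) < nu.
Implicit Types u z : R.

Let c (k : nat) : R := (-1) ^+ k / (k`!%:R * Gamma (k%:R + nu + 1)).

Let c_rec k : k.+1%:R * (k%:R + nu + 1) * c k.+1 = - c k.
Proof.
have k0 : 0 <= k%:R :> R by [].
have knu : 0 < k%:R + nu + 1 by move: k0 hnu; move: (k%:R : R) => y; lra.
rewrite /c -[in Gamma _]addn1 natrD -[k%:R + 1 + nu]addrAC Gamma_recurrence//.
rewrite factS natrM !invfM exprS; set G := (Gamma _)^-1.
have f0 : k`!%:R != 0 :> R by rewrite pnatr_eq0 -lt0n fact_gt0.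
have : k.+1%:R != 0 :> R by [].
rewrite -natr1 => k1; field.
by rewrite k1 f0 gt_eqF.
Qed.

Let exp_bounded_c : exp_bounded c.
Proof.
(* As k + nu + 1 >= 1 / 2, [c_rec] gives |c_(k+1)| <= 2 |c_k| / (k + 1), whence the constants |c_0|
   and 2. *)
clearbody c; exists (`|c 0%N|, 2) => //=; elim=> [|k ih]; first by rewrite expr0 mulr1 fact0 divr1.
have k0 : 0 <= k%:R :> R by [].
have knu : 1 / 2 <= k%:R + nu + 1 by move: k0 hnu; move: (k%:R : R) => y; lra.
have f0 : 0 < k`!%:R :> R by rewrite ltr0n fact_gt0.
have k1 : 0 < k.+1%:R :> R by [].
rewrite factS natrM ler_pdivlMr ?mulr_gt0//.
move: ih; rewrite ler_pdivlMr// -(normrN (c k)) -c_rec !normrM.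
rewrite (ger0_norm (ltW k1)) (ger0_norm (le_trans _ knu)) ?divr_ge0//.
rewrite exprS => ih.
have : 1 / 2 * (k.+1%:R * `|c k.+1| * k`!%:R) <=
   (k%:R + nu + 1) * (k.+1%:R * `|c k.+1| * k`!%:R).
  by rewrite ler_wpM2r// !mulr_ge0// ltW.
move: ih; move: (k%:R + nu + 1) (k.+1%:R : R) (`|c k.+1|) (k`!%:R : R) (`|c 0| : R) (2 ^+ k : R).
move=> s t u v w z h1 h2.
have -> : u * (t * v) = t * u * v by ring.
have -> : w * (2 * z) = 2 * (w * z) by ring.
have e1 : t * s * u * v = s * (t * u * v) by ring.
by move: h1 h2; rewrite e1; lra.
Qed.

Let P := psum c.
Let P1 := psum (pseries_diffs c).
Let P2 := psum (pseries_diffs (pseries_diffs c)).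

Let bessel_ode z : z * P2 z + (nu + 1) * P1 z + P z = 0.
Proof.
have h1 := exp_bounded_diffs exp_bounded_c.
have h2 := exp_bounded_diffs h1.
(* Multiplication by z raises degrees by one. Truncating P'' at [n] and the other two series at
   [n.+1] aligns the powers, and [c_rec] makes each partial combination exactly zero. *)
have cv : (fun n => z * pseries (pseries_diffs (pseries_diffs c)) z n +
     (nu + 1) * pseries (pseries_diffs c) z n.+1 + pseries c z n.+1) @ \oo -->
    z * P2 z + (nu + 1) * P1 z + P z.
  apply: cvgD; [apply: cvgD; apply: cvgMr|].
  - exact: pseries_cvg.
  - by rewrite (cvg_shiftS (pseries _ z)); exact: pseries_cvg.
  - by rewrite (cvg_shiftS (pseries _ z)); exact: pseries_cvg.
rewrite -(cvg_lim _ cv)// (_ : (fun n => _) = fun=> 0) ?lim_cst//.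
apply/funext => n.
have -> : z * pseries (pseries_diffs (pseries_diffs c)) z n =
   \sum_(0 <= k < n.+1) k%:R * (k.+1%:R * c k.+1) * z ^+ k.
  rewrite big_nat_recl//= mul0r mul0r add0r /pseries/series/= mulr_sumr.
  by apply: eq_bigr => k _; rewrite /pseries_diffs exprS; ring.
rewrite /pseries/series/= mulr_sumr -!big_split/= big1// => k _.
by rewrite -[c k]opprK -c_rec /pseries_diffs; ring.
Qed.

Lemma besselJ_psum u : 0 < u ->
  besselJ nu u = (u / 2) `^ nu * P (u ^+ 2 / 4).
Proof.
move=> u0; have u2 : 0 < u / 2 by rewrite divr_gt0.
rewrite /besselJ (_ : series _ = fun n => (u / 2) `^ nu * pseries c (u ^+ 2 / 4) n).
  by apply/cvg_lim => //; apply: cvgMr; exact: pseries_cvg.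
apply/funext => n; rewrite /pseries/series/= mulr_sumr; apply: eq_bigr => k _.
rewrite /bessel_coef -/(c k) powRD_gt0//.
rewrite powR_mulrn ?ltW// -mul2n exprM.
have -> : (u / 2) ^+ 2 = u ^+ 2 / 4 by field.
by ring.
Qed.

(** For u > 0 this is (u / 2)^(-nu) J_nu(u). It extends continuously to the origin, and Bessel's
    equation becomes q'' + (2 nu + 1) / u q' + q = 0. *)
Let q u := P (u ^+ 2 / 4).
Let q1 u := P1 (u ^+ 2 / 4) * (u / 2).
Let q2 u := P2 (u ^+ 2 / 4) * (u ^+ 2 / 4) + P1 (u ^+ 2 / 4) / 2.

Let is_derive_sq u : is_derive u 1 (fun u : R => u ^+ 2 / 4) (u / 2).
Proof.
under eq_fun do rewrite mulrC.
have := is_derive_mull (4^-1 : R) (is_derive_exprn 2 u).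
by rewrite expr1 (_ : _ * _ = u / 2)//; field.
Qed.

Let is_derive_q u : is_derive u 1 q (q1 u).
Proof.
have h := is_derive_psum (u ^+ 2 / 4) exp_bounded_c.
exact: (@is_derive1_comp R P (fun u => u ^+ 2 / 4) u _ _ h (is_derive_sq u)).
Qed.

Let is_derive_q1 u : is_derive u 1 q1 (q2 u).
Proof.
have h := is_derive_psum (u ^+ 2 / 4) (exp_bounded_diffs exp_bounded_c).
have h1 := @is_derive1_comp R P1 (fun u => u ^+ 2 / 4) u _ _ h (is_derive_sq u).
have h2 : is_derive u 1 (fun u : R => u / 2) 2^-1.
  under eq_fun do rewrite mulrC.
  by have := is_derive_mull 2^-1 (is_derive_id u 1); rewrite mulr1.
have := is_derive_mul h1 h2; rewrite (_ : _ + _ = q2 u)//.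
by rewrite /q2 /= -/P2; field.
Qed.

Let q_ode u : u != 0 -> q2 u = - (q u + (2 * nu + 1) / u * q1 u).
Proof.
move=> u0; rewrite /q2 /q /q1; have := bessel_ode (u ^+ 2 / 4).
move=> ode; have -> : P (u ^+ 2 / 4) =
    - (u ^+ 2 / 4 * P2 (u ^+ 2 / 4) + (nu + 1) * P1 (u ^+ 2 / 4)).
  by apply/eqP; rewrite -addr_eq0 addrC; apply/eqP.
by field.
Qed.

Let continuous_q : continuous q.
Proof.
move=> u; apply: differentiable_continuous; apply/derivable1_diffP.
by have [] := is_derive_q u.
Qed.

Lemma besselJ_sqrE u : 0 < u ->
  u * besselJ nu u ^+ 2 = (2^-1 `^ nu) ^+ 2 * (u `^ (2 * nu + 1) * q u ^+ 2).
Proof.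
move=> u0; rewrite besselJ_psum// powRM ?ltW// -/(q u).
rewrite powRD_gt0// powRr1 ?ltW//.
have -> : u `^ (2 * nu) = (u `^ nu) ^+ 2.
  by rewrite [2 * nu]mulrC powRrM powR_mulrn// powR_ge0.
by ring.
Qed.

(* Up to constants [u^p q] is [sqrt u J_nu], with derivative [u^p V]; Bessel's
   equation makes the logarithmic derivative of [u^(2 p) energy] at most
   [kappa / u^2], which is integrable at infinity. *)
Let p := nu + 1 / 2.
Let kappa := `|p ^+ 2 - p|.
Let V u := q1 u + p * q u / u.
Let energy u := q u ^+ 2 + V u ^+ 2.
Let H u := u `^ (2 * nu + 1) * expR (kappa / u) * energy u.

Let is_derive_inv (u : R) : u != 0 -> is_derive u 1 (fun u => u^-1) (- u ^- 2).
Proof.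
move=> u0; have := is_deriveV u0 (is_derive_id u 1).
by rewrite /GRing.scale/= mulr1.
Qed.

Let is_derive_V u : u != 0 ->
  is_derive u 1 V (q2 u + (p * q1 u / u - p * q u / u ^+ 2)).
Proof.
move=> u0; apply: is_deriveD => //.
have := is_derive_mul (is_derive_mull p (is_derive_q u)) (is_derive_inv u0).
by rewrite (_ : _ + _ = p * q1 u / u - p * q u / u ^+ 2)//; ring.
Qed.

(** v = u^p q satisfies v'' = -(1 - (p^2 - p) / u^2) v, where p^2 - p = nu^2 - 1 / 4. Hence v^2 +
    v'^2 = u^(2 p) energy changes only through the cross term 2 (p^2 - p) q V / u^2. The factor
    exp(kappa / u) contributes -kappa energy / u^2, which dominates that term because 2 |q V| <=
    energy. *)
Let is_derive_H u : 0 < u -> is_derive u 1 H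
  (u `^ (2 * nu + 1) * expR (kappa / u) / u ^+ 2 *
    (2 * (p ^+ 2 - p) * q u * V u - kappa * energy u)).
Proof.
move=> u0; have u0' : u != 0 by rewrite gt_eqF.
have d1 := @is_derive1_powR R (2 * nu + 1) u u0.
have d2 := @is_derive1_comp R expR (fun u => kappa / u) u _ _
  (is_derive_expR (kappa / u)) (is_derive_mull kappa (is_derive_inv u0')).
have dq := is_derive_mul (is_derive_q u) (is_derive_q u).
have dV := is_derive_mul (is_derive_V u0') (is_derive_V u0').
have dE : is_derive u 1 energy _ := is_deriveD dq dV.
have dH : is_derive u 1 H _ := is_derive_mul (is_derive_mul d1 d2) dE.
apply: is_derive_eq dH _.
rewrite powRD_gt0// powR_inv1 ?ltW//= q_ode//.
have -> : energy u = q u ^+ 2 + V u ^+ 2 by [].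
have -> : q1 u = V u - p * q u / u by rewrite /V; ring.
rewrite /p; move: (V u) (q u) (u `^ (2 * nu + 1)) (expR (kappa / u)) => v y a b; move: kappa => k.
by field.
Qed.

Let H_nonincreasing (a : R) u : 0 < a -> a <= u -> H u <= H a.
Proof.
move=> a0 au; rewrite -lerN2.
apply: (@is_derive_ge0_le R (fun x => - H x) (fun x =>
  - (x `^ (2 * nu + 1) * expR (kappa / x) / x ^+ 2 *
    (2 * (p ^+ 2 - p) * q x * V x - kappa * energy x)))) => // x /andP[ax xu].
  by apply: is_deriveN; apply: is_derive_H; exact: lt_le_trans ax.
rewrite oppr_ge0 mulr_ge0_le0//.
  by rewrite divr_ge0 ?mulr_ge0 ?powR_ge0 ?expR_ge0 ?exprn_ge0// (le_trans (ltW a0)).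
rewrite /kappa subr_le0; apply: le_trans (ler_norm _) _.
rewrite -!mulrA normrM ger0_norm// normrM mulrCA ler_wpM2l//.
rewrite /energy normrM.
have := sqr_ge0 (`|q x| - `|V x|); rewrite sqrrB !real_normK ?num_real//.
lra.
Qed.

(** Since exp(kappa / u) >= 1 and energy >= q^2, [H u] is at least u^(2 nu + 1) q(u)^2, and [H]
    decreases from [H a]. *)
Lemma besselJ_sqr_le_infty a : 0 < a ->
  exists2 C : R, 0 <= C & forall u, a <= u -> u * besselJ nu u ^+ 2 <= C.
Proof.
move=> a0; exists ((2^-1 `^ nu) ^+ 2 * H a).
  by rewrite mulr_ge0 ?sqr_ge0// !mulr_ge0 ?powR_ge0 ?expR_ge0// addr_ge0 ?sqr_ge0.
move=> u au; have u0 := lt_le_trans a0 au.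
rewrite besselJ_sqrE// ler_wpM2l ?sqr_ge0//.
apply: le_trans (H_nonincreasing a0 au).
rewrite /H -mulrA ler_wpM2l ?powR_ge0//.
apply: (@le_trans _ _ (1 * energy u)); first by rewrite mul1r lerDl sqr_ge0.
rewrite ler_wpM2r ?addr_ge0 ?sqr_ge0//.
by apply: le_trans (expR_ge1Dx _); rewrite lerDl divr_ge0 ?normr_ge0// ltW.
Qed.

Lemma besselJ_sqr_le_origin b : 0 < b -> exists2 C : R, 0 <= C &
  forall u, 0 < u <= b -> u * besselJ nu u ^+ 2 <= C * u `^ (2 * nu + 1).
Proof.
move=> b0.
have [|m _ hm] := @EVT_max R (fun u => q u ^+ 2) 0 b (ltW b0).
  apply: continuous_subspaceT => u.
  by under eq_fun do rewrite expr2; apply: cvgM; exact: continuous_q.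
exists ((2^-1 `^ nu) ^+ 2 * q m ^+ 2); first by rewrite mulr_ge0 ?sqr_ge0.
move=> u /andP[u0 ub]; rewrite besselJ_sqrE// -mulrA ler_wpM2l ?sqr_ge0//.
rewrite mulrC ler_wpM2r ?powR_ge0//; apply: hm.
by rewrite in_itv/= ub ltW.
Qed.

Lemma measurable_besselJ_sqr :
  measurable_fun (`]0, +oo[%classic : set R) (fun u => u * besselJ nu u ^+ 2).
Proof.
apply: (@eq_measurable_fun _ _ _ _ _
    (fun u => (2^-1 `^ nu) ^+ 2 * (u `^ (2 * nu + 1) * q u ^+ 2))).
  by move=> u; rewrite inE/= in_itv/= andbT => /besselJ_sqrE ->.
apply/(@measurable_funS _ _ _ _ setT) => //.
apply: measurable_funM => //; apply: measurable_funM; first exact: measurable_powR.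
apply: measurable_funX; exact: continuous_measurable_fun.
Qed.

End Bessel.

(** * Integrals of completely monotone functions *)

Section Integrals.
Variable R : realType.
Local Notation mu := (@lebesgue_measure R).
Implicit Types (u y d s : R).

Lemma lebesgue_measure_scale (s : R) (A : set R) : 0 < s -> measurable A ->
  pushforward mu ( *%R s : _ -> measurableTypeR R) A = (s^-1%:E * mu A)%E.
Proof.
move=> s0 mA.
have mphi : measurable_fun [set: measurableTypeR R] ( *%R s : _ -> measurableTypeR R).
  exact: mulrl_measurable.
pose k : {nonneg R} := NngNum (ltW s0).
pose m' : {measure set (measurableTypeR R) -> \bar R} :=
  mscale k (pushforward mu ( *%R s : _ -> measurableTypeR R)).
pose m := m' mphi.
suff : mu A = m A.
  by move=> ->; rewrite /m/= /mscale/= muleA -EFinM mulVf ?gt_eqF// mul1e.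
apply: lebesgue_measure_unique => // _ [[a b]] _ <-.
have -> : m `]a, b]%classic = (s%:E * mu (( *%R s) @^-1` `]a, b]))%E by [].
have -> : ( *%R s) @^-1` `]a, b]%classic = `](a / s), (b / s)]%classic.
  apply/seteqP; split => x /=; rewrite !in_itv/= ltr_pdivrMr// ler_pdivlMr//;
  by rewrite ![x * s]mulrC.
rewrite !lebesgue_measure_itv/= !lte_fin ltr_pM2r ?invr_gt0//.
case: ifPn => _; last by rewrite mule0.
rewrite -EFinB -EFinM; congr EFin; field.
by rewrite gt_eqF.
Qed.

Lemma ge0_integral_scale (s : R) (h : R -> \bar R) : 0 < s ->
  measurable_fun (`]0, +oo[%classic : set R) h -> (forall u, 0 < u -> (0 <= h u)%E) ->
  (\int[mu]_(r in `]0%R, +oo[) h (s * r)%R =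
   s^-1%:E * \int[mu]_(u in `]0%R, +oo[) h u)%E.
Proof.
move=> s0 mh h0.
have mphi : measurable_fun [set: measurableTypeR R] ( *%R s : _ -> measurableTypeR R).
  exact: mulrl_measurable.
have D0 : {in (`]0, +oo[%classic : set R), forall u, (0 <= h u)%E}.
  by move=> u; rewrite inE/= in_itv/= andbT; exact: h0.
have := @ge0_integral_pushforward _ _ _ _ R _ mphi mu `]0%R, +oo[%classic h
   (measurable_itv _) mh D0.
have -> : ( *%R s : _ -> measurableTypeR R) @^-1` `]0%R, +oo[%classic = `]0%R, +oo[%classic.
  by apply/seteqP; split => x /=; rewrite !in_itv/= !andbT pmulr_rgt0.
move=> <-.
have k0 : 0 <= s^-1 by rewrite invr_ge0 ltW.
pose k : {nonneg R} := NngNum k0.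
rewrite -[s^-1]/(k%:num) -ge0_integral_mscale//; last first.
  by move=> u; rewrite /= in_itv/= andbT; exact: h0.
apply: eq_measure_integral => A mA _.
exact: lebesgue_measure_scale.
Qed.

Lemma completely_monotone_continuous (g : R -> R) n (x : R) :
  completely_monotone g -> 0 < x -> {for x, continuous (g^`(n))%classic}.
Proof.
move=> cm x0; apply: differentiable_continuous; apply/derivable1_diffP.
by have [] := cm n x x0.
Qed.

Lemma completely_monotone_ge0 (g : R -> R) (x : R) :
  completely_monotone g -> 0 < x -> 0 <= g x.
Proof. by move=> cm x0; have [_] := cm 0%N x x0; rewrite expr0 mul1r. Qed.

Lemma measurable_completely_monotone_sqr (g : R -> R) n (y : R) :
  completely_monotone g -> 0 < y ->
  measurable_fun (`]0, +oo[%classic : set R) (fun u => (g^`(n))%classic (u ^+ 2 * y)).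
Proof.
move=> cm y0; apply: open_continuous_measurable_fun; first exact: interval_open.
move=> u; rewrite inE/= in_itv/= andbT => u0.
apply: (@cvg_comp _ _ _ (fun u => u ^+ 2 * y) (g^`(n))%classic _ (nbhs (u ^+ 2 * y))).
  by apply: cvgMl; exact: exprn_continuous.
by apply: completely_monotone_continuous => //; rewrite mulr_gt0 ?exprn_gt0.
Qed.

Section TaylorIntegral.
Variables (w g : R -> R).
Hypothesis mw : measurable_fun (`]0, +oo[%classic : set R) w.
Hypothesis w0 : forall u, 0 < u -> 0 <= w u.
Hypothesis cm : completely_monotone g.

Let G y := (\int[mu]_(u in `]0%R, +oo[) (w u * g (u ^+ 2 * y))%:E)%E.
Hypothesis Gfin : forall y, 0 < y -> (G y < +oo)%E.

(** For fixed u, [g] is expanded at u^2 y0 with increment u^2 d; the condition for convergence is d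
    < y0 / 2 whatever u is. All terms are nonnegative, so sum and integral commute. *)
Lemma completely_monotone_integral_taylor (y0 : R) : 0 < y0 ->
  exists2 A : nat -> R, (forall n, 0 <= A n) &
    forall d, 0 <= d < y0 / 2 ->
      series (fun n => A n * d ^+ n) @ \oo --> fine (G (y0 - d)).
Proof.
move=> y00.
pose a n u := w u * ((-1) ^+ n * (g^`(n))%classic (u ^+ 2 * y0)) * (u ^+ 2) ^+ n / n`!%:R.
have a0 n u : 0 < u -> 0 <= a n u.
  move=> u0; have uy : 0 < u ^+ 2 * y0 by rewrite mulr_gt0 ?exprn_gt0.
  rewrite /a; apply: divr_ge0 => //; apply: mulr_ge0; last exact/exprn_ge0/sqr_ge0.
  by apply: mulr_ge0; [exact: w0|have [] := cm n uy].
have ma n : measurable_fun (`]0, +oo[%classic : set R) (a n).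
  apply: measurable_funM => //; apply: measurable_funM.
    apply: measurable_funM => //; apply: measurable_funM => //.
    exact: measurable_completely_monotone_sqr.
  by do 2 apply: measurable_funX.
pose I n := (\int[mu]_(u in `]0%R, +oo[) (a n u)%:E)%E.
have I0 n : (0 <= I n)%E.
  by apply: integral_ge0 => u; rewrite /= in_itv/= andbT lee_fin => /a0.
have GE d : 0 <= d < y0 / 2 -> G (y0 - d) = (\sum_(n <oo) ((d ^+ n)%:E * I n))%E.
  move=> /andP[d0 dy].
  transitivity (\int[mu]_(u in `]0%R, +oo[) (\sum_(n <oo) (a n u * d ^+ n)%:E))%E.
    apply: eq_integral => u; rewrite inE/= in_itv/= andbT => u0.
    have uu : 0 < u ^+ 2 by rewrite exprn_gt0.
    have am := completely_monotone_absolutely_monotone (x := u ^+ 2 * y0) cm.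
    have ud : 0 <= u ^+ 2 * d < u ^+ 2 * y0 / 2.
      by rewrite mulr_ge0 ?(ltW uu)//= -mulrA ltr_pM2l.
    have := absolutely_monotone_taylor_cvg am ud.
    rewrite expr0 mul1r -mulrBr => cv.
    have {}cv : series (fun n => a n u * d ^+ n) @ \oo --> w u * g (u ^+ 2 * (y0 - d)).
      rewrite (_ : series _ = fun N => w u * series (fun n =>
        (-1) ^+ n * (g^`(n))%classic (u ^+ 2 * y0 - 0) * (u ^+ 2 * d) ^+ n / n`!%:R) N).
        by apply: cvgMr; exact: cv.
      apply/funext => N; rewrite /series/= mulr_sumr; apply: eq_bigr => n _.
      by rewrite /a subr0 [(_ * d) ^+ n]exprMn; ring.
    apply/esym/cvg_lim => //.
    rewrite (_ : (fun n => _) = EFin \o series (fun n => a n u * d ^+ n)).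
      by apply: cvg_EFin; [near=> N|exact: cv].
    by apply/funext => N /=; rewrite sumEFin.
  rewrite integral_nneseries//.
  - apply: eq_eseriesr => n _; rewrite -ge0_integralZl_EFin ?exprn_ge0//.
    + by apply: eq_integral => u _; rewrite -EFinM mulrC.
    + by move=> u; rewrite /= in_itv/= andbT lee_fin => /a0.
    + apply/measurable_EFinP; exact: ma.
  - by move=> n; apply/measurable_EFinP; apply: measurable_funM; [exact: ma|exact: measurable_cst].
  - move=> n u; rewrite /= in_itv/= andbT lee_fin => u0.
    by rewrite mulr_ge0 ?a0 ?exprn_ge0.
have Ifin n : I n \is a fin_num.
  rewrite ge0_fin_numE//.
  (* At any positive d of the admissible range, a single term of the series is bounded by its finite
     sum; y0 / 3 is such a d. *)
  have d3 : 0 <= y0 / 3 < y0 / 2 by lra.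
  have : (((y0 / 3) ^+ n)%:E * I n < +oo)%E.
    apply: le_lt_trans (Gfin (_ : 0 < y0 - y0 / 3)); last by lra.
    rewrite GE//; apply: le_trans (nneseries_lim_ge n.+1 _) => [|k _ _]; last first.
      by rewrite mule_ge0// lee_fin exprn_ge0//; lra.
    rewrite big_nat_recr//=; apply: leeDr; apply: sume_ge0 => k _.
    by rewrite mule_ge0// lee_fin exprn_ge0//; lra.
  have d30 : 0 < (y0 / 3) ^+ n by rewrite exprn_gt0//; lra.
  have := I0 n; move: (I n) => [r _ _|_|//]; first exact: ltry.
  by rewrite gt0_muley ?lte_fin// ltxx.
exists (fun n => fine (I n)) => [n|d dd]; first exact: fine_ge0.
have /andP[d0 dy] := dd.
have IE : (\sum_(n <oo) ((d ^+ n)%:E * I n) = \sum_(n <oo) (fine (I n) * d ^+ n)%:E)%E.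
  by apply: eq_eseriesr => n _; rewrite EFinM fineK// muleC.
have := Gfin (_ : 0 < y0 - d); rewrite GE// IE => /(_ ltac:(lra)) fin.
have p0 n : 0 <= fine (I n) * d ^+ n by rewrite mulr_ge0 ?fine_ge0 ?exprn_ge0.
have cv := nnseries_is_cvg p0 fin.
rewrite (_ : (\sum_(n <oo) _)%E = (limn (series (fun n => fine (I n) * d ^+ n)))%:E)//.
apply/cvg_lim => //.
rewrite (_ : (fun n => _) = EFin \o series (fun n => fine (I n) * d ^+ n)).
  by apply: cvg_EFin; [near=> N|exact: cv].
by apply/funext => N /=; rewrite sumEFin.
Unshelve. all: by end_near. Qed.

End TaylorIntegral.
End Integrals.

(** * Analyticity of the transform *)

Section Final.
Variable R : realType.
Local Notation mu := (@lebesgue_measure R).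
Implicit Types (u y d s t : R).

Section Analytic.
Variables (G : R -> R) (y0 : R) (A : nat -> R).
Hypothesis A0 : forall n, 0 <= A n.
Hypothesis GA : forall d, 0 <= d < y0 / 2 -> series (fun n => A n * d ^+ n) @ \oo --> G (y0 - d).

(* The base point [y0 = 4 / (3 s0^2)] lies to the right of [1 / s0^2], so that
   [y0 - 1 / (s0 + t)^2] stays in the region [0 <= d < y0 / 2]. *)
Lemma power_series_comp_inv_sqr s0 : 0 < s0 -> y0 = 4 / 3 * s0 ^- 2 ->
  exists M, power_series_norm_le (s0 / 10) M (fun t => G ((s0 + t) ^- 2)).
Proof.
move=> s00 y0E; have rho0 : 0 <= s0 / 10 by lra.
have i0 : 0 < s0 ^- 2 by rewrite invr_gt0 exprn_gt0.
have s00' : s0 != 0 by rewrite gt_eqF.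
have inv : power_series_norm_le (s0 / 10) (s0 - s0 / 10)^-1 (fun t => (s0 + t)^-1).
  by apply: power_series_norm_le_inv; lra.
have num : power_series_norm_le (s0 / 10) (`|2 * s0| + s0 / 10) (fun t => 2 * s0 + t).
  apply: power_series_norm_leD => //; first exact: power_series_norm_le_cst.
  exact: power_series_norm_le_id.
(* This writes d = y0 - (s0 + t)^(-2) as y0 / 4 + s0^(-2) t (2 s0 + t) (s0 + t)^(-2). The constant
   y0 / 4 is the value at t = 0, and the explicit factor t keeps the norm of the rest small. *)
have dPS := power_series_norm_leD (power_series_norm_le_cst (s0 / 10) (y0 / 4))
  (power_series_norm_leM rho0 (power_series_norm_leM rho0 (power_series_norm_le_cst _ (s0 ^- 2))
   (power_series_norm_leM rho0 (power_series_norm_le_id rho0) num))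
   (power_series_norm_leX 2 rho0 inv)) rho0.
move: dPS; set M := (X in power_series_norm_le _ X _) => dPS.
(* In units of s0^(-2) the norm is 16 / 27, below y0 / 2 = 18 / 27. This is what the radius s0 / 10
   is chosen for. *)
have ME : M = (1 / 3 + 7 / 27) * s0 ^- 2.
  rewrite /M !ger0_norm ?(ltW i0)//; [|by lra|by rewrite y0E; lra].
  by rewrite y0E; field; rewrite s00' gt_eqF//; lra.
have M0 : 0 <= M < y0 / 2 by rewrite ME y0E; lra.
exists (G (y0 - M)).
apply: (@power_series_norm_le_superposition R (s0 / 10) (G (y0 - M)) A (fun n => M ^+ n)
  _ _ rho0 (fun n => power_series_norm_leX n rho0 dPS)) => [N|t ht].
  under eq_bigr do rewrite ger0_norm//.
  rewrite -(cvg_lim (@norm_hausdorff _ _) (GA M0)).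
  apply: (nondecreasing_cvgn_le (u_ := series (fun n => A n * M ^+ n))).
    apply: nondecreasing_series => k _ _; apply: mulr_ge0 => //; apply: exprn_ge0.
    by case/andP: M0.
  by apply/cvg_ex; eexists; exact: GA.
have [t1 t2] : - (s0 / 10) <= t /\ t <= s0 / 10 by apply/andP; rewrite -ler_norml.
have st0' : 0 < s0 + t by lra.
have st0 : s0 + t != 0 by rewrite gt_eqF.
have := power_series_norm_le_bound dPS ht.
set d := _ + _ => dM.
have dE : d = y0 - (s0 + t) ^- 2 by rewrite /d y0E; field; rewrite s00' st0.
rewrite -[X in G X](subKr y0) -dE; apply: GA.
apply/andP; split; last first.
  by apply: le_lt_trans (ler_norm _) (le_lt_trans dM _); case/andP: M0.
rewrite dE subr_ge0 y0E -(invrK (4 / 3)) -invfM lef_pV2 ?posrE ?mulr_gt0 ?exprn_gt0//.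
(* This says (s0 + t)^2 >= (81 / 100) s0^2, which exceeds the required (3 / 4) s0^2, so that d >=
   0. *)
have : 0 <= (s0 + t - 9 / 10 * s0) * (s0 + t + 9 / 10 * s0) by apply: mulr_ge0; lra.
have : 0 <= s0 ^+ 2 by rewrite sqr_ge0.
rewrite !expr2.
by move=> ? ?; lra.
Qed.

End Analytic.

Lemma cvg_real_complex (u : nat -> R) (l : R) : u @ \oo --> l ->
  (fun n => (u n)%:C : R[i]^o) @ \oo --> (l%:C : R[i]^o).
Proof.
(* The tolerance is a positive element of [R[i]]; positivity there forces the imaginary part [e'] to
   be 0. *)
move=> ul; apply/cvgrPdist_le => -[e e'] /=.
rewrite ltcE /= => /andP[/eqP -> e0].
have /cvgrPdist_le/(_ _ e0) := ul; apply: filterS => n.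
by rewrite -raddfB /= normc_def /= expr0n/= addr0 sqrtr_sqr lecR.
Qed.

Section Corollary.
Variables (nu0 nu : R) (f : R -> R[i]) (g : R -> R).
Hypothesis hnu0 : - (1 / 2) < nu0.
Hypothesis hnu : nu0 <= nu.
Hypothesis hf : in_L1 (2 * nu0 + 1) 0 f.
Hypothesis cm : completely_monotone g.
Hypothesis fg : forall r : R, 0 < r -> f (Num.sqrt r) = (g r)%:C.

Let f_sqr r : 0 < r -> f r = (g (r ^+ 2))%:C.
Proof. by move=> r0; rewrite -fg ?exprn_gt0// sqrtr_sqr gtr0_norm. Qed.

Let w u := u * besselJ nu u ^+ 2.

Let w0 u : 0 < u -> 0 <= w u.
Proof. by move=> u0; rewrite mulr_ge0 ?sqr_ge0// ltW. Qed.

Let hnu' : - (1 / 2) < nu. Proof. exact: lt_le_trans hnu. Qed.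

Let G y := (\int[mu]_(u in `]0%R, +oo[) (w u * g (u ^+ 2 * y))%:E)%E.

Let measurable_G y : 0 < y ->
  measurable_fun (`]0, +oo[%classic : set R) (fun u => (w u * g (u ^+ 2 * y))%:E).
Proof.
move=> y0; apply/measurable_EFinP; apply: measurable_funM.
  exact: measurable_besselJ_sqr.
exact: (@measurable_completely_monotone_sqr R g 0).
Qed.

Let G_scale s : 0 < s ->
  (\int[mu]_(r in `]0%R, +oo[) (w (s * r) * g (r ^+ 2))%:E = s^-1%:E * G (s ^- 2))%E.
Proof.
move=> s0; have i0 : 0 < s ^- 2 by rewrite invr_gt0 exprn_gt0.
rewrite /G -(@ge0_integral_scale R s (fun u => (w u * g (u ^+ 2 * s ^- 2))%:E))//.
- apply: eq_integral => r _; congr (_ * g _)%:E.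
  by rewrite exprMn mulrAC mulfV ?mul1r// expf_neq0// gt_eqF.
- exact: measurable_G.
- move=> u u0; rewrite lee_fin mulr_ge0 ?w0//.
  by rewrite completely_monotone_ge0// mulr_gt0 ?exprn_gt0.
Qed.

Let measurable_g (D : set R) : measurable D -> D `<=` `]0, +oo[ ->
  measurable_fun D (fun r => g (r ^+ 2)).
Proof.
move=> mD D0; apply: (@measurable_funS _ _ _ _ (`]0, +oo[%classic : set R)) => //.
rewrite (_ : (fun r => _) = (fun u => (g^`(0))%classic (u ^+ 2 * 1))).
  exact: measurable_completely_monotone_sqr.
by apply/funext => u; rewrite mulr1.
Qed.

Let measurable_scaled s (D : set R) : 0 < s -> measurable D -> D `<=` `]0, +oo[ ->
  measurable_fun D (fun r => (w (s * r) * g (r ^+ 2))%:E).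
Proof.
move=> s0 mD D0; apply: (@measurable_funS _ _ _ _ (`]0, +oo[%classic : set R)) => //.
apply/measurable_EFinP; apply: measurable_funM; last first.
  exact: measurable_g.
apply: (@measurable_comp _ _ _ _ _ _ (`]0, +oo[%classic : set R)) => //.
- by move=> _ [r /=] + <-; rewrite !in_itv/= !andbT => r0; exact: mulr_gt0.
- exact: measurable_besselJ_sqr.
Qed.

(** The two weights defining the space of [f] match the two Bessel bounds: w(s r) = O(r^(2 nu + 1))
    for r < 1 and w(s r) = O(1) for r >= 1. The cut r = 1 is u = s, hence the threshold [s] in both
    bounds. *)
Let integral_scaled_lty s : 0 < s ->
  (\int[mu]_(r in `]0%R, +oo[) (w (s * r) * g (r ^+ 2))%:E < +oo)%E.
Proof.
move=> s0; have [_ ] := hf.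
have [C0 C00 hC0] := besselJ_sqr_le_origin hnu' s0.
have [C1 C10 hC1] := besselJ_sqr_le_infty hnu' s0.
have g0 r : 0 < r -> 0 <= g (r ^+ 2).
  by move=> r0; rewrite completely_monotone_ge0 ?exprn_gt0.
have normf r : 0 < r -> Normc.normc (f r) = g (r ^+ 2).
  by move=> r0; rewrite f_sqr//= expr0n addr0 sqrtr_sqr ger0_norm// g0.
have s01 : `]0, 1[ `<=` (`]0, +oo[%classic : set R).
  by move=> r /=; rewrite !in_itv/= andbT => /andP[].
have s1y : `[1, +oo[ `<=` (`]0, +oo[%classic : set R).
  by move=> r /=; rewrite !in_itv/= !andbT => /(lt_le_trans ltr01).
have s1y' : `]1, +oo[ `<=` (`]0, +oo[%classic : set R).
  by move=> r /=; rewrite !in_itv/= !andbT => /(lt_trans ltr01).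
have -> : (\int[mu]_(r in `]0%R, 1%R[) (Normc.normc (f r) * r `^ (2 * nu0 + 1))%:E =
    \int[mu]_(r in `]0%R, 1%R[) (g (r ^+ 2) * r `^ (2 * nu0 + 1))%:E)%E.
  by apply: eq_integral => r; rewrite inE => /s01/=; rewrite in_itv/= andbT => /normf ->.
have -> : (\int[mu]_(r in `]1%R, +oo[) (Normc.normc (f r) * r `^ 0)%:E =
    \int[mu]_(r in `[1%R, +oo[) (g (r ^+ 2))%:E)%E.
  (* Adding the null point r = 1 makes the two intervals cover the half-line. *)
  rewrite -integral_itv_obnd_cbnd; last by apply/measurable_EFinP; exact: measurable_g.
  apply: eq_integral => r; rewrite inE => /s1y'/=; rewrite in_itv/= andbT => /normf ->.
  by rewrite powRr0 mulr1.
set I0 := (X in (X + _)%E); set I1 := (X in (_ + X)%E) => fin.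
have I00 : (0 <= I0)%E.
  apply: integral_ge0 => r /s01/=; rewrite in_itv/= andbT => r0.
  by rewrite lee_fin mulr_ge0 ?powR_ge0 ?g0.
have I10 : (0 <= I1)%E.
  by apply: integral_ge0 => r /s1y/=; rewrite in_itv/= andbT => r0; rewrite lee_fin g0.
have [I0fin I1fin] : (I0 < +oo)%E /\ (I1 < +oo)%E.
  by split; apply: le_lt_trans fin; [exact: leeDl|exact: leeDr].
have -> : `]0%R, +oo[%classic = `]0%R, 1%R[ `|` `[1%R, +oo[ :> set R.
  apply/seteqP; split => r /=; rewrite !in_itv/= !andbT.
    by move=> r0; have [r1|r1] := ltP r 1; [left|right]; rewrite ?r0.
  by move=> [/andP[]//|]; exact: lt_le_trans.
rewrite ge0_integral_setU//; first last.
- apply/disj_setPS => r /= []; rewrite !in_itv/= andbT => /andP[_ r1].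
  by rewrite leNgt r1.
- move=> r rU; have r0 : 0 < r.
    by case: rU => [/s01|/s1y] /=; rewrite in_itv/= andbT.
  by rewrite lee_fin mulr_ge0 ?g0 ?w0 ?mulr_gt0.
- apply: measurable_scaled => //; first exact: measurableU.
  by move=> r [/s01|/s1y].
apply: lte_add_pinfty.
- apply: (@le_lt_trans _ _ ((C0 * s `^ (2 * nu + 1))%:E * I0)%E); last first.
    by rewrite lte_mul_pinfty// lee_fin mulr_ge0 ?powR_ge0.
  rewrite -ge0_integralZl_EFin//; last 3 first.
  + move=> r /s01/=; rewrite in_itv/= andbT => r0.
    by rewrite lee_fin mulr_ge0 ?powR_ge0 ?g0.
  + apply/measurable_EFinP; apply: measurable_funM; first exact: measurable_g.
    by apply: (@measurable_funS _ _ _ _ setT) => //; exact: measurable_powR.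
  + by rewrite mulr_ge0 ?powR_ge0.
  apply: ge0_le_integral => //.
  + move=> r /s01/=; rewrite in_itv/= andbT => r0.
    by rewrite lee_fin mulr_ge0 ?g0 ?w0 ?mulr_gt0.
  + exact: measurable_scaled.
  + apply/measurable_EFinP; apply: measurable_funM => //.
    apply: measurable_funM; first exact: measurable_g.
    by apply: (@measurable_funS _ _ _ _ setT) => //; exact: measurable_powR.
  move=> r; rewrite /= in_itv/= => /andP[r0 r1].
  rewrite -EFinM lee_fin mulrCA [leLHS]mulrC ler_wpM2l ?g0//.
  apply: le_trans (hC0 (s * r) _) _.
    by rewrite mulr_gt0//= ger_pMr// ltW.
  rewrite (powRM _ (ltW s0) (ltW r0)) -mulrA ler_wpM2l// ler_wpM2l ?powR_ge0//.
  (* Here [nu0 <= nu] enters: for r < 1 the larger exponent 2 nu + 1 gives the smaller power. *)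
  apply: ger_powR; first by rewrite r0 ltW.
  by move: hnu; lra.
- apply: (@le_lt_trans _ _ (C1%:E * I1)%E); last first.
    by rewrite lte_mul_pinfty// lee_fin.
  rewrite -ge0_integralZl_EFin//; last 2 first.
  + by move=> r /s1y/=; rewrite in_itv/= andbT => r0; rewrite lee_fin g0.
  + by apply/measurable_EFinP; exact: measurable_g.
  apply: ge0_le_integral => //.
  + move=> r /s1y/=; rewrite in_itv/= andbT => r0.
    by rewrite lee_fin mulr_ge0 ?g0 ?w0 ?mulr_gt0.
  + exact: measurable_scaled.
  + by apply/measurable_EFinP; apply: measurable_funM => //; exact: measurable_g.
  move=> r; rewrite /= in_itv/= andbT => r1.
  have r0 := lt_le_trans ltr01 r1.
  rewrite -EFinM lee_fin ler_wpM2r ?g0//; apply: hC1.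
  by rewrite ler_pMr.
Qed.

Let G_lty y : 0 < y -> (G y < +oo)%E.
Proof.
(* With s = y^(-1/2) one has s^(-2) = y, so the scaled integral is a positive multiple of [G y]. *)
move=> y0; have s0 : 0 < (Num.sqrt y)^-1 by rewrite invr_gt0 sqrtr_gt0.
have := integral_scaled_lty s0; rewrite G_scale// -exprVn invrK sqr_sqrtr ?ltW//.
have : (0 <= G y)%E.
  apply: integral_ge0 => u; rewrite /= in_itv/= andbT lee_fin => u0.
  by rewrite mulr_ge0 ?w0 ?completely_monotone_ge0 ?mulr_gt0 ?exprn_gt0.
move: (G y) => [r _ _|_|//]; first exact: ltry.
by rewrite gt0_muley ?lte_fin ?invr_gt0 ?sqrtr_gt0// ltxx.
Qed.

Lemma T_transformE s : 0 < s ->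
  T_transform nu f s = (pi * (s^-1 * fine (G (s ^- 2))))%:C.
Proof.
move=> s0; rewrite /T_transform /complex_integral.
have -> : \int[mu]_(r in `]0, +oo[)
    complex.Im ((r * s * besselJ nu (r * s) ^+ 2)%:C * f r) = 0.
  rewrite (@eq_Rintegral _ _ _ mu _ (cst 0)); last first.
    by move=> r; rewrite inE/= in_itv/= andbT => r0; rewrite f_sqr//=; ring.
  by rewrite /Rintegral integral0.
have -> : \int[mu]_(r in `]0, +oo[)
    complex.Re ((r * s * besselJ nu (r * s) ^+ 2)%:C * f r) = s^-1 * fine (G (s ^- 2)).
  rewrite (@eq_Rintegral _ _ _ mu _ (fun r => w (s * r) * g (r ^+ 2))); last first.
    move=> r; rewrite inE/= in_itv/= andbT => r0; rewrite f_sqr//= mul0r subr0.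
    by rewrite /w [s * r]mulrC.
  rewrite /Rintegral G_scale// fineM// ge0_fin_numE; first by rewrite G_lty ?invr_gt0 ?exprn_gt0.
  apply: integral_ge0 => u; rewrite /= in_itv/= andbT lee_fin => u0.
  by rewrite mulr_ge0 ?w0 ?completely_monotone_ge0 ?mulr_gt0 ?invr_gt0 ?exprn_gt0.
by rewrite -/((s^-1 * fine (G (s ^- 2)))%:C) -rmorphM.
Qed.

Lemma T_transform_real_analytic : real_analytic_on `]0, +oo[ (T_transform nu f).
Proof.
move=> s0; rewrite /= in_itv/= andbT => s00.
pose y0 := 4 / 3 * s0 ^- 2.
have y00 : 0 < y0 by rewrite mulr_gt0 ?invr_gt0 ?exprn_gt0//; lra.
have [A A0 GA] := completely_monotone_integral_taylor
  (measurable_besselJ_sqr hnu') w0 cm G_lty y00.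
have [M PS] := @power_series_comp_inv_sqr (fun y => fine (G y)) y0 A A0 GA s0 s00 erefl.
have rho0 : 0 <= s0 / 10 by lra.
have inv : power_series_norm_le (s0 / 10) (s0 - s0 / 10)^-1 (fun t => (s0 + t)^-1).
  by apply: power_series_norm_le_inv; lra.
have [b _ bT] := power_series_norm_leM rho0 (power_series_norm_le_cst _ pi)
  (power_series_norm_leM rho0 inv PS).
exists (fun n => (b n)%:C); near=> x.
have xs : `|x - s0| <= s0 / 10.
  near: x; apply/nbhs_ballP; exists (s0 / 10) => /=; first by lra.
  by move=> y; rewrite /ball/= distrC => /ltW.
have x0 : 0 < x by move: xs; rewrite ler_norml => /andP[? ?]; lra.
rewrite T_transformE// -{2 3}(subrKC s0 x).
rewrite (_ : series _ = fun n => (series (fun k => b k * (x - s0) ^+ k) n)%:C).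
  by apply: cvg_real_complex; exact: bT.
apply/funext => n; rewrite /series/= rmorph_sum.
by apply: eq_bigr => k _; rewrite rmorphM rmorphXn.
Unshelve. all: by end_near. Qed.

End Corollary.
End Final.

Theorem corollary1p7 (R : realType) (nu0 : R) (hnu0 : - (1 / 2) < nu0)
    (f : R -> R[i]) (hf : in_L1 (2 * nu0 + 1) 0 f)
    (hcm : exists2 g : R -> R, completely_monotone g &
             forall r : R, 0 < r -> f (Num.sqrt r) = (g r)%:C)
    (nu : R) (hnu : nu0 <= nu) :
  real_analytic_on `]0, +oo[ (T_transform nu f).
Proof. by have [g cm fg] := hcm; exact: (T_transform_real_analytic hnu0 hnu hf cm fg). Qed.
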